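(* Let $\overline{M}$ be a smooth manifold with boundary, of dimension $n\ge2$, endowed with a smooth projective structure. If there are a point $p\in\partial M$ and a boundary chart $(r,y^1,\dots,y^{n-1})$ near $p$ such that $\Pi^0_\nu(p)\in\mathrm{span}(\mathrm{d}r_p)$ for all $1\le\nu\le n-1$, then the same holds in any boundary chart near $p$ (with $\Pi$ and $r$ the Thomas invariant and boundary defining function of that chart).
   Context: Two torsion-free affine connections $\nabla,\hat\nabla$ on $\overline{M}$ are projectively equivalent if there is a $1$-form $\Upsilon$ with $\hat\nabla_XY=\nabla_XY+\Upsilon(X)Y+\Upsilon(Y)X$ for all vector fields $X,Y$. A projective structure on $\overline{M}$ is a class $[\nabla]$ of projectively equivalent torsion-free affine connections. A boundary chart is a chart $(U,(r,y^1,\dots,y^{n-1}))$ in which $r$ is a boundary defining function: $\partial M\cap U=\{r=0\}$ and $\mathrm{d}r$ is nowhere zero on $\partial M\cap U$. Put $x^0=r$, $x^\mu=y^\mu$. Latin indices range over $0,\dots,n-1$, Greek indices over $1,\dots,n-1$; repeated indices are summed. In a chart $(x^i)$, if $\nabla$ is a connection in the class with Christoffel symbols $\Gamma^i_{jk}$, the (local) Thomas invariant is $\Pi^i_{jk}=\Gamma^i_{jk}-\frac{1}{n+1}\Gamma^l_{lk}\delta^i_j-\frac{1}{n+1}\Gamma^l_{lj}\delta^i_k$; it does not depend on the choice of $\nabla$ in the class. One writes $\Pi^i_j=\Pi^i_{jk}\,\mathrm{d}x^k$ (a $1$-form for each $i,j$). *)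

(* Defs.v *)
From mathcomp Require Import all_boot all_order all_algebra.
From mathcomp Require Import all_classical all_reals all_analysis.
Import numFieldNormedType.Exports.

Set Implicit Arguments.
Unset Strict Implicit.
Unset Printing Implicit Defensive.

Import Order.TTheory GRing.Theory Num.Theory.
Local Open Scope classical_set_scope.
Local Open Scope ring_scope.

(* The dimension is m.+1: R^(m+1) is 'rV[R]_m.+1, its coordinates are indexed
   by 'I_m.+1 = {0, ..., m}, and a point x has coordinates x 0 i. *)

Section EuclideanSmoothness.
Variables (R : realType) (m : nat).
Implicit Types (O : set 'rV[R]_m.+1) (F : 'rV[R]_m.+1 -> R).

Fixpoint Ck_on (k : nat) O F : Prop :=
  match k with
  | 0 => forall x, O x -> {for x, continuous F}
  | k'.+1 => (forall x, O x -> differentiable F x) /\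
             (forall i : 'I_m.+1, Ck_on k' O (fun x => 'D_(delta_mx 0 i) F x))
  end.

Definition smooth_near F (a : 'rV[R]_m.+1) :=
  exists O, [/\ open O, O a & forall k, Ck_on k O F].

Definition half_space : set 'rV[R]_m.+1 := [set x | 0 <= x 0 0].

End EuclideanSmoothness.

(* A topological chart: a homeomorphism from an open set onto a subset of
   R^(m+1) (with the subspace topology).  The values of [coord] outside [dom]
   are irrelevant. *)
Record chart (R : realType) (m : nat) (T : topologicalType) := Chart {
  dom : set T;
  coord :> T -> 'rV[R]_m.+1;
  dom_open : open dom;
  coord_continuous : forall p, dom p -> {for p, continuous coord};
  coord_inj : {in dom &, injective coord};
  coord_open_image : forall V : set T, open V -> V `<=` dom ->
    exists2 O : set 'rV[R]_m.+1, open O & coord @` V = O `&` coord @` dom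
}.

Section ChartSmoothness.
Variables (R : realType) (m : nat) (T : topologicalType).
Implicit Types (c : chart R m T) (p : T) (f : T -> R).

Definition chart_fun c (i : 'I_m.+1) : T -> R := fun p => c p 0 i.

(* F is a smooth extension, to a neighbourhood of c p in R^(m+1), of the local
   expression of f in the chart c near p.  As usual for manifolds with
   boundary, smoothness at a boundary point means having such an extension. *)
Definition local_expression c p f (F : 'rV[R]_m.+1 -> R) :=
  smooth_near F (c p) /\ \forall q \near p, f q = F (c q).

Definition smooth_in c p f := exists F, local_expression c p f F.

Definition compatible c c' := forall p, dom c p -> dom c' p ->
  forall i, smooth_in c p (chart_fun c' i) /\ smooth_in c' p (chart_fun c i).

End ChartSmoothness.

(* A smooth manifold with boundary of dimension m.+1.  The atlas is given as
   a family with a preferred chart around each point; each of its charts maps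
   onto a relatively open subset of the half space {x^0 >= 0}. *)
Record bmanifold (R : realType) (m : nat) := BManifold {
  carrier :> topologicalType;
  carrier_hausdorff : hausdorff_space carrier;
  carrier_second_countable : @second_countable carrier;
  chart_at : carrier -> chart R m carrier;
  chart_at_dom : forall p, dom (chart_at p) p;
  chart_at_image : forall p, exists2 O : set 'rV[R]_m.+1, open O &
    chart_at p @` dom (chart_at p) = O `&` @half_space R m;
  chart_at_compatible : forall p q, compatible (chart_at p) (chart_at q)
}.

Section Geometry.
Variables (R : realType) (m : nat) (M : bmanifold R m).
Implicit Types (p q : M) (f : M -> R) (U : set M) (c : chart R m M).

(* By invariance of the boundary, any other chart of the atlas around p would
   do. *)
Definition mboundary : set M := [set p | chart_at p p 0 0 = 0].

(* An arbitrary chart of the smooth structure; its image in R^(m+1) is not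
   required to lie in a particular half space. *)
Definition is_chart c := forall p, compatible (chart_at p) c.

Definition smooth_at p f := smooth_in (chart_at p) p f.

Definition smooth_fun U f := forall p, U p -> smooth_at p f.

(* The tangent space at p is identified with R^(m+1) through the chart
   [chart_at p].  [dfun f p v] is df_p(v); it does not depend on the extension
   chosen by [xget], since the local expression of f determines the
   extension on the half space near the image of p. *)
Definition dfun f p (v : 'rV[R]_m.+1) : R :=
  'D_v (xget (cst 0) (local_expression (chart_at p) p f)) (chart_at p p).

Definition vfield := M -> 'rV[R]_m.+1.
Implicit Types X Y Z : vfield.

Definition apply_field X f : M -> R := fun p => dfun f p (X p).

(* For p in U, the components of X in the chart around p are smooth near p. *)
Definition smooth_field U X := forall p, U p ->
  forall i, smooth_at p (apply_field X (chart_fun (chart_at p) i)).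

Definition smooth_oneform (w : M -> 'cV[R]_m.+1) :=
  forall U X, open U -> smooth_field U X ->
    smooth_fun U (fun p => (X p *m w p) 0 0).

(* Affine connections, as covariant derivatives acting on local vector fields:
   for X and Y smooth on an open set U, nabla X Y on U is a smooth field that
   depends only on X and Y on U.  The values of nabla X Y at points near which
   X and Y are not smooth are irrelevant. *)
Record affine_connection (nabla : vfield -> vfield -> vfield) : Prop := {
  nabla_smooth : forall U X Y, open U -> smooth_field U X -> smooth_field U Y ->
    smooth_field U (nabla X Y);
  nabla_local : forall U X X' Y Y', open U ->
    smooth_field U X -> smooth_field U Y ->
    {in U, X =1 X'} -> {in U, Y =1 Y'} ->
    {in U, nabla X Y =1 nabla X' Y'};
  nablaDl : forall U X X' Y, open U ->
    smooth_field U X -> smooth_field U X' -> smooth_field U Y ->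
    {in U, forall p, nabla (fun q => X q + X' q) Y p
                     = nabla X Y p + nabla X' Y p};
  nablaZl : forall U f X Y, open U ->
    smooth_fun U f -> smooth_field U X -> smooth_field U Y ->
    {in U, forall p, nabla (fun q => f q *: X q) Y p = f p *: nabla X Y p};
  nablaDr : forall U X Y Y', open U ->
    smooth_field U X -> smooth_field U Y -> smooth_field U Y' ->
    {in U, forall p, nabla X (fun q => Y q + Y' q) p
                     = nabla X Y p + nabla X Y' p};
  nabla_leibniz : forall U f X Y, open U ->
    smooth_fun U f -> smooth_field U X -> smooth_field U Y ->
    {in U, forall p, nabla X (fun q => f q *: Y q) p
                     = apply_field X f p *: Y p + f p *: nabla X Y p}
}.

(* nabla_X Y - nabla_Y X = [X, Y], both sides acting on smooth functions. *)
Definition torsion_free (nabla : vfield -> vfield -> vfield) :=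
  forall U X Y f, open U ->
    smooth_field U X -> smooth_field U Y -> smooth_fun U f ->
    {in U, forall p, dfun f p (nabla X Y p - nabla Y X p)
      = apply_field X (apply_field Y f) p - apply_field Y (apply_field X f) p}.

Definition projectively_equivalent (nabla nabla' : vfield -> vfield -> vfield) :=
  exists2 w : M -> 'cV[R]_m.+1, smooth_oneform w &
    forall U X Y, open U -> smooth_field U X -> smooth_field U Y ->
    {in U, forall p, nabla' X Y p
      = nabla X Y p + (X p *m w p) 0 0 *: Y p + (Y p *m w p) 0 0 *: X p}.

Definition projective_structure (C : set (vfield -> vfield -> vfield)) :=
  exists nabla, [/\ affine_connection nabla, torsion_free nabla &
    C = [set nabla' | [/\ affine_connection nabla', torsion_free nabla' &
                          projectively_equivalent nabla nabla']]].

Section InChart.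
Variables (c : chart R m M) (nabla : vfield -> vfield -> vfield).

(* The coordinate field d/dx^i on dom c, characterized by dx^j (d/dx^i) =
   delta_ij: row i of the inverse of the matrix with entries dx^j (e_k). *)
Definition coord_field (i : 'I_m.+1) : vfield := fun p =>
  row i (invmx (\matrix_(k, j) dfun (chart_fun c j) p (delta_mx 0 k))).

(* nabla_(d_j) d_k = Gamma^i_jk d_i *)
Definition christoffel (i j k : 'I_m.+1) (p : M) : R :=
  dfun (chart_fun c i) p (nabla (coord_field j) (coord_field k) p).

(* The dimension is n = m.+1, so that n + 1 = m.+2. *)
Definition thomas (i j k : 'I_m.+1) (p : M) : R :=
  christoffel i j k p
  - (m.+2)%:R^-1 * (\sum_l christoffel l l k p) * (i == j)%:R
  - (m.+2)%:R^-1 * (\sum_l christoffel l l j p) * (i == k)%:R.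

(* Pi^i_j = Pi^i_jk dx^k *)
Definition thomas_form (i j : 'I_m.+1) (p : M) (v : 'rV[R]_m.+1) : R :=
  \sum_k thomas i j k p * dfun (chart_fun c k) p v.

(* Pi^0_nu (p) lies in span(dx^0_p), as a linear form on the tangent space. *)
Definition thomas_normal (p : M) :=
  forall nu : 'I_m.+1, nu != 0 ->
    exists a : R, forall v,
      thomas_form 0 nu p v = a * dfun (chart_fun c 0) p v.

End InChart.

Definition boundary_chart c :=
  [/\ is_chart c,
      mboundary `&` dom c = [set p | dom c p /\ chart_fun c 0 p = 0] &
      forall p, (mboundary `&` dom c) p ->
        exists v, dfun (chart_fun c 0) p v != 0].

End Geometry.

(* Main.v *)
(* For tangential indices j, k the component Pi^0_jk equals Gamma^0_jk, so the
   condition at p says that dr(nabla_(d_j) d_k) = 0 at p for j, k <> 0, and it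
   can be tested on one connection of the class.  Two boundary defining
   functions have the same zero set, hence at every boundary point their
   differentials have the same kernel, the tangent space of the boundary.  Expand the
   tangential coordinate fields X, Y of a second boundary chart in the
   coordinate fields of the first, Y = sum_b Y^b d_b: then
   dr(nabla_X Y) = X(Y^0) + sum_ab X^a Y^b Gamma^0_ab, where X^0 = Y^0 = 0 on the
   boundary, so that X(Y^0) = 0 at p because X is tangent to the boundary, and
   the terms with a, b <> 0 vanish by hypothesis. *)
Require Import Defs.
From mathcomp Require Import all_boot all_order all_algebra.
From mathcomp Require Import all_classical all_reals all_analysis.
Import numFieldNormedType.Exports.
Import Order.TTheory GRing.Theory Num.Theory.
Local Open Scope classical_set_scope.
Local Open Scope ring_scope.

Set Implicit Arguments.
Unset Strict Implicit.
Unset Printing Implicit Defensive.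

(** * Directional derivatives and one-sided comparison *)

Section DirectionalDerivatives.
Context {R : realType} {V : normedModType R}.
Implicit Types (F G : V -> R) (a v : V).

(** The first-order expansion of [F] at [a] only sees values near [a], so it is also one for [G];
    uniqueness of its linear part identifies ['d F a] with ['d G a]. *)
Lemma near_eq_differentiable F G a :
  (\forall x \near a, F x = G x) -> differentiable F a -> differentiable G a.
Proof.
move=> FG dF.
have [cF eF] := (diff_locallyP a F).1 dF.
have FGa : F a = G a by exact: nbhs_singleton FG.
have eG : G \o shift a = cst (G a) + 'd F a +o_ (nbhs (0 : V)) id.
  apply/eqaddoP => e e0; have /eqaddoP/(_ e e0) := eF.
  have : \forall h \near (0 : V), F (h + a) = G (h + a).
    by move: FG; rewrite (near_shift 0 a) subr0.
  apply: filterS2 => h FGh.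
  by rewrite /= -FGa -![(_ + _) h]/(_ h + _ h) -![(- _) h]/(- _ h) /= FGh.
by apply/diff_locallyP; rewrite (diff_unique cF eG).
Qed.

Lemma near_line a v (P : V -> Prop) :
  (\forall x \near a, P x) -> \forall h \near (0 : R), P (h *: v + a).
Proof.
have c : h *: v + a @[h --> (0 : R)] --> a.
  rewrite -[X in _ --> X]add0r -[X in _ --> X + _](scale0r v).
  by apply: cvgD; [apply: cvgZr_tmp; exact: cvg_id | exact: cvg_cst].
by move=> aP; apply: c.
Qed.

Lemma derive_ge0 F a v : differentiable F a ->
  (\forall h \near 0^'+, F a <= F (h *: v + a)) -> 0 <= 'D_v F a.
Proof.
move=> dF nF; have dv := @diff_derivable _ _ _ F a v dF.
apply: (cvgr_to_ge (cvg_dnbhs_at_right dv)).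
near=> h; rewrite /= mulr_ge0 ?invr_ge0 ?subr_ge0 //.
by near: h.
Unshelve. all: by end_near. Qed.

Lemma derive_diffB F G a v : differentiable F a -> differentiable G a ->
  'D_v (F - G) a = 'D_v F a - 'D_v G a.
Proof. by move=> dF dG; rewrite deriveB //; exact: diff_derivable. Qed.

(** A two-sided limit is determined by its right-hand side; the sign criterion applied to [F - G]
    and [G - F] gives both inequalities. This serves to compare functions known to agree only on a
    half space. *)
Lemma derive_eq_right F G a v : differentiable F a -> differentiable G a ->
  F a = G a ->
  (\forall h \near 0^'+, F (h *: v + a) = G (h *: v + a)) ->
  'D_v F a = 'D_v G a.
Proof.
move=> dF dG Fa FG.
have le0 (F' G' : V -> R) : differentiable F' a -> differentiable G' a ->
    F' a = G' a -> (\forall h \near 0^'+, F' (h *: v + a) = G' (h *: v + a)) ->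
    0 <= 'D_v (F' - G') a.
  move=> dF' dG' E FG'; apply: derive_ge0; first exact: differentiableB.
  apply: filterS FG' => h E'.
  by rewrite -![(_ - _) _]/(_ - _) E E' !subrr.
apply/eqP; rewrite eq_le; apply/andP; split; rewrite -subr_ge0 -derive_diffB //.
  by apply: le0 => //; apply: filterS FG => h ->.
exact: le0.
Qed.

Lemma derive_dirN F a v : differentiable F a -> 'D_(- v) F a = - 'D_v F a.
Proof. by move=> dF; rewrite !deriveE // linearN. Qed.

End DirectionalDerivatives.

Lemma derive_partials {R : realType} {m : nat} (F : 'rV[R]_m.+1 -> R)
    (a v : 'rV[R]_m.+1) : differentiable F a ->
  'D_v F a = \sum_i v 0 i * 'D_(delta_mx 0 i) F a.
Proof.
move=> dF; rewrite deriveE // {1}(row_sum_delta v) linear_sum.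
by apply: eq_bigr => i _; rewrite linearZ deriveE.
Qed.

(** * Vector-valued maps given by components, and the chain rule *)

Section RowVectors.
Context {R : realType} {m n : nat}.
Implicit Types (a v : 'rV[R]_m.+1).
Implicit Type K : 'I_n.+1 -> 'rV[R]_m.+1 -> R.

Definition row_fun K (x : 'rV[R]_m.+1)
  : 'rV[R]_n.+1 := \row_j K j x.

Lemma row_funE K : row_fun K = \sum_j (fun x => K j x *: delta_mx 0 j).
Proof.
apply/funext => x; rewrite fct_sumE (row_sum_delta (row_fun K x)).
by apply: eq_bigr => j _; rewrite mxE.
Qed.

Lemma row_fun_differentiable K a :
  (forall j, differentiable (K j) a) -> differentiable (row_fun K) a.
Proof.
move=> dK; rewrite row_funE; apply: differentiable_sum => j.
exact: differentiableZl.
Qed.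

Lemma row_fun_cvg K a : (forall j, {for a, continuous (K j)}) ->
  {for a, continuous (row_fun K)}.
Proof.
move=> cK; rewrite row_funE.
elim/big_ind : _ => [|f g cf cg|j _]; first exact: cst_continuous.
  exact: continuousD.
exact: cvgZr_tmp (cK j).
Qed.

Lemma derive_row_fun_comp (F : 'rV[R]_n.+1 -> R) K a v :
  (forall j, differentiable (K j) a) -> differentiable F (row_fun K a) ->
  'D_v (F \o row_fun K) a =
  \sum_j 'D_v (K j) a * 'D_(delta_mx 0 j) F (row_fun K a).
Proof.
move=> dK dF; have dr := row_fun_differentiable dK.
rewrite deriveE; last exact: differentiable_comp.
rewrite diff_comp //= -(deriveE _ dF) derive_partials // -(deriveE _ dr).
apply: eq_bigr => j _; congr (_ * _).
rewrite derive_mx; last exact: diff_derivable.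
by rewrite mxE; congr derive; apply/funext => x; rewrite mxE.
Qed.

End RowVectors.

(** * Closure properties of smooth functions on open subsets of Euclidean space *)

Section SmoothFunctions.
Context {R : realType} {m : nat}.
Implicit Types (O : set 'rV[R]_m.+1) (F G : 'rV[R]_m.+1 -> R) (a : 'rV[R]_m.+1).

Lemma eq_Ck_on k O F G : open O -> (forall x, O x -> F x = G x) ->
  Ck_on k O F -> Ck_on k O G.
Proof.
move=> oO; elim: k F G => [|k IH] F G FG.
  move=> cF x Ox; have FGx : \forall y \near x, F y = G y.
    by apply: filterS FG _; exact: open_nbhs_nbhs.
  move=> A; rewrite -(FG x Ox) => /(cF x Ox) AF.
  have {}AF : \forall y \near x, A (F y) by [].
  suff: \forall y \near x, A (G y) by [].
  by move: FGx AF; apply: filterS2 => y ->.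
have nFG x (Ox : O x) : \forall y \near x, F y = G y.
  by apply: filterS FG _; exact: open_nbhs_nbhs.
move=> [dF CF]; split=> [x Ox|i].
  exact: near_eq_differentiable (nFG x Ox) (dF x Ox).
by apply: IH (CF i) => x Ox; apply: near_eq_derive; exact: nFG.
Qed.

Lemma Ck_onS k O F : Ck_on k.+1 O F -> Ck_on k O F.
Proof.
elim: k F => [|k IH] F [dF CF].
  by move=> x Ox; apply: differentiable_continuous; exact: dF.
by split=> // i; apply: IH; exact: CF.
Qed.

Lemma Ck_on_sub k O O' F : O' `<=` O -> Ck_on k O F -> Ck_on k O' F.
Proof.
move=> s; elim: k F => [|k IH] F; first by move=> cF x /s; exact: cF.
by move=> [dF CF]; split=> [x /s|i]; [exact: dF | exact: IH (CF i)].
Qed.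

Lemma Ck_on_cst k O (r : R) : Ck_on k O (cst r).
Proof.
elim: k r => [|k IH] r; first by move=> x _; exact: cst_continuous.
split=> [x _|i]; first exact: differentiable_cst.
by rewrite (_ : (fun x => _) = cst 0) //; apply/funext => x; rewrite derive_cst.
Qed.

Lemma Ck_onD k O F G : open O -> Ck_on k O F -> Ck_on k O G ->
  Ck_on k O (fun x => F x + G x).
Proof.
move=> oO; elim: k F G => [|k IH] F G.
  by move=> cF cG x Ox; exact: continuousD (cF x Ox) (cG x Ox).
move=> [dF CF] [dG CG]; split=> [x Ox|i].
  by apply: differentiableD; [exact: dF | exact: dG].
apply: eq_Ck_on (IH _ _ (CF i) (CG i)) => // x Ox.
by rewrite [RHS]deriveD //; apply: diff_derivable; [exact: dF | exact: dG].
Qed.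

Lemma Ck_onM k O F G : open O -> Ck_on k O F -> Ck_on k O G ->
  Ck_on k O (fun x => F x * G x).
Proof.
move=> oO; elim: k F G => [|k IH] F G.
  by move=> cF cG x Ox; exact: continuousM (cF x Ox) (cG x Ox).
move=> CF CG; have [dF pF] := CF; have [dG pG] := CG; split=> [x Ox|i].
  by apply: differentiableM; [exact: dF | exact: dG].
(* In the Leibniz rule the undifferentiated factors have order [k.+1] and are lowered to [k], the
   order of the partial derivatives. *)
apply: eq_Ck_on (Ck_onD oO (IH _ _ (Ck_onS CF) (pG i)) (IH _ _ (Ck_onS CG) (pF i))) => //.
by move=> x Ox; rewrite [RHS]deriveM //; apply: diff_derivable; [exact: dF | exact: dG].
Qed.

Lemma Ck_on_sum k O (n : nat) (F : 'I_n -> 'rV[R]_m.+1 -> R) : open O ->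
  (forall i, Ck_on k O (F i)) -> Ck_on k O (fun x => \sum_i F i x).
Proof.
move=> oO; elim: n F => [|n IH] F CF.
  by under eq_fun do rewrite big_ord0; exact: Ck_on_cst.
under eq_fun do rewrite big_ord_recl.
by apply: Ck_onD => //; exact: IH.
Qed.

Lemma Ck_on_coord k O i : Ck_on k O (fun x => x 0 i).
Proof.
case: k => [|k]; first by move=> x _; exact: coord_continuous.
have d (x : 'rV[R]_m.+1) : differentiable (fun y : 'rV[R]_m.+1 => y 0 i : R) x.
  exact: differentiable_coord.
split=> [x _|j]; first exact: d.
rewrite (_ : (fun x => _) = cst ((delta_mx 0 j : 'rV[R]_m.+1) 0 i)).
  exact: Ck_on_cst.
apply/funext => x; have id_der : derivable (@id 'rV[R]_m.+1) x (delta_mx 0 j) by [].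
have := derive_mx id_der; rewrite derive_id => /matrixP/(_ 0 i).
by rewrite [RHS]mxE /cst => ->.
Qed.

(** By the chain rule a partial derivative of the composite is a sum of products of partials of
    [K j] with partials of [F] composed with the same map, so the induction on [k] must range over
    all [F]. *)
Lemma Ck_on_comp k O (n : nat) (O' : set 'rV[R]_n.+1) (F : 'rV[R]_n.+1 -> R)
    (K : 'I_n.+1 -> 'rV[R]_m.+1 -> R) :
  open O -> (forall x, O x -> O' (row_fun K x)) ->
  (forall j, Ck_on k O (K j)) -> Ck_on k O' F -> Ck_on k O (F \o row_fun K).
Proof.
move=> oO OK; elim: k F => [|k IH] F CK CF.
  move=> x Ox; apply: continuous_comp; last exact/CF/OK.
  by apply: row_fun_cvg => j; exact: CK.
have [dF pF] := CF.
have dK x j : O x -> differentiable (K j) x by move=> Ox; have [+ _] := CK j; exact.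
split=> [x Ox|i].
  apply: differentiable_comp; last exact/dF/OK.
  by apply: row_fun_differentiable => j; exact: dK.
apply: (@eq_Ck_on _ _ (fun x => \sum_j 'D_(delta_mx 0 i) (K j) x *
    (fun y => 'D_(delta_mx 0 j) F y) (row_fun K x))) => //.
  move=> x Ox; rewrite [RHS]derive_row_fun_comp //; last exact/dF/OK.
  by move=> j; exact: dK.
apply: Ck_on_sum => // j; apply: Ck_onM => //; first by have [_] := CK j; exact.
by apply: IH (pF j) => l; apply: Ck_onS; exact: CK.
Qed.

Lemma smooth_near_open F a : smooth_near F a -> \forall x \near a, smooth_near F x.
Proof.
move=> [W [oW Wa CF]]; apply: filterS (open_nbhs_nbhs (conj oW Wa)) => x Wx.
by exists W.
Qed.

Lemma smooth_near_differentiable F a : smooth_near F a -> differentiable F a.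
Proof. by move=> [W [_ Wa /(_ 1)[+ _]]]; exact. Qed.

Lemma smooth_near_continuous F a : smooth_near F a -> {for a, continuous F}.
Proof. by move=> /smooth_near_differentiable; exact: differentiable_continuous. Qed.

Lemma smooth_near_cst (r : R) a : smooth_near (cst r) a.
Proof. by exists setT; split=> [||k] //; [exact: openT | exact: Ck_on_cst]. Qed.

Lemma smooth_near_coord i a : smooth_near (fun x => x 0 i) a.
Proof. by exists setT; split=> [||k] //; [exact: openT | exact: Ck_on_coord]. Qed.

Lemma smooth_near_partial F a i : smooth_near F a ->
  smooth_near (fun x => 'D_(delta_mx 0 i) F x) a.
Proof. by move=> [W [oW Wa CF]]; exists W; split=> // k; have [_] := CF k.+1; exact. Qed.

Lemma smooth_nearD F G a : smooth_near F a -> smooth_near G a ->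
  smooth_near (fun x => F x + G x) a.
Proof.
move=> [W [oW Wa CF]] [W' [oW' W'a CG]]; have oI := openI oW oW'.
exists (W `&` W'); split=> // k; apply: Ck_onD => //.
  by apply: Ck_on_sub (CF k) => x [].
by apply: Ck_on_sub (CG k) => x [].
Qed.

Lemma smooth_nearM F G a : smooth_near F a -> smooth_near G a ->
  smooth_near (fun x => F x * G x) a.
Proof.
move=> [W [oW Wa CF]] [W' [oW' W'a CG]]; have oI := openI oW oW'.
exists (W `&` W'); split=> // k; apply: Ck_onM => //.
  by apply: Ck_on_sub (CF k) => x [].
by apply: Ck_on_sub (CG k) => x [].
Qed.

Lemma smooth_near_comp (K : 'I_m.+1 -> 'rV[R]_m.+1 -> R) F a :
  (forall j, smooth_near (K j) a) -> smooth_near F (row_fun K a) ->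
  smooth_near (F \o row_fun K) a.
Proof.
move=> sK [W' [oW' W'a CF]].
have [P PW] := choice sK.
(* Taking interiors makes [W] open at once; that [a] lies in it follows from the finiteness of the
   index set and from continuity at [a]. *)
pose W := interior [set x | forall j, P j x] `&`
          interior (row_fun K @^-1` W').
have oW : open W by apply: openI; exact: open_interior.
have sOP j : W `<=` P j by move=> x [/interior_subset + _]; exact.
exists W; split=> // [|k]; first split.
- suff: \forall x \near a, forall j, P j x by [].
  apply: (filter_forall (nbhs_filter a)) => j.
  by have [oP Pa _] := PW j; exact: open_nbhs_nbhs.
- have cK : {for a, continuous (row_fun K)}.
    by apply: row_fun_cvg => j; exact: smooth_near_continuous.
  by apply: cK; exact: open_nbhs_nbhs.
apply: (Ck_on_comp (O' := W')) (CF k) => // [x [_ /interior_subset]|j] //.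
by have [_ _ CP] := PW j; exact: Ck_on_sub (CP k).
Qed.

End SmoothFunctions.

(** * Local expressions of functions and change of chart *)

Section LocalExpressions.
Context {R : realType} {m : nat} {T : topologicalType}.
Implicit Types (c : chart R m T) (p q : T) (f g : T -> R).

Lemma local_expression_near c p f F : dom c p -> local_expression c p f F ->
  \forall q \near p, dom c q /\ local_expression c q f F.
Proof.
move=> cp [sF fF].
have cF : \forall q \near p, smooth_near F (c q).
  exact: Defs.coord_continuous cp _ (smooth_near_open sF).
have cd : \forall q \near p, dom c q by exact: open_nbhs_nbhs (conj (dom_open c) cp).
have fF' := nbhs_interior fF.
near=> q; split; first by near: q.
by split; near: q.
Unshelve. all: by end_near. Qed.

(** The functions [K i] are the components of a smooth extension of the transition map from [c'] to
    [c]. *)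
Lemma local_expression_comp c c' p f F K :
  (forall i, local_expression c' p (chart_fun c i) (K i)) ->
  local_expression c p f F -> local_expression c' p f (F \o row_fun K).
Proof.
move=> cK [sF fF].
have KE : \forall q \near p, row_fun K (c' q) = c q.
  have : \forall q \near p, forall i, chart_fun c i q = K i (c' q).
    by apply: (filter_forall (nbhs_filter p)) => i; have [] := cK i.
  by apply: filterS => q Kq; apply/rowP => i; rewrite mxE -Kq.
split.
  by apply: smooth_near_comp => [j|]; [have [] := cK j | rewrite (nbhs_singleton KE)].
by apply: filterS2 fF KE => q -> /= ->.
Qed.

Lemma smooth_in_change c c' p f :
  (forall i, smooth_in c' p (chart_fun c i)) ->
  smooth_in c p f -> smooth_in c' p f.
Proof.
move=> /choice[K cK] [F fF]; exists (F \o row_fun K).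
exact: local_expression_comp cK fF.
Qed.

Lemma near_eq_smooth_in c p f g :
  (\forall q \near p, f q = g q) -> smooth_in c p f -> smooth_in c p g.
Proof.
move=> fg [F [sF fF]]; exists F; split=> //.
by apply: filterS2 fg fF => q ->.
Qed.

Lemma smooth_in_cst c p (r : R) : smooth_in c p (cst r).
Proof.
by exists (cst r); split; [exact: smooth_near_cst | exact: nearW].
Qed.

Lemma smooth_inD c p f g : smooth_in c p f -> smooth_in c p g ->
  smooth_in c p (fun q => f q + g q).
Proof.
move=> [F [sF fF]] [G [sG gG]]; exists (fun x => F x + G x); split.
  exact: smooth_nearD.
by apply: filterS2 fF gG => q -> ->.
Qed.

Lemma smooth_inM c p f g : smooth_in c p f -> smooth_in c p g ->
  smooth_in c p (fun q => f q * g q).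
Proof.
move=> [F [sF fF]] [G [sG gG]]; exists (fun x => F x * G x); split.
  exact: smooth_nearM.
by apply: filterS2 fF gG => q -> ->.
Qed.

Lemma local_expression_coord c p i :
  local_expression c p (chart_fun c i) (fun x => x 0 i).
Proof. by split; [exact: smooth_near_coord | exact: nearW]. Qed.

End LocalExpressions.

(** * Differentials and coordinate fields on the manifold *)

Section Differentials.
Context {R : realType} {m : nat} {M : bmanifold R m}.
Implicit Types (p q : M) (f g : M -> R) (c : chart R m M) (v w : 'rV[R]_m.+1).

Lemma chart_at_ge0 p q : dom (chart_at p) q -> 0 <= chart_at p q 0 0.
Proof.
move=> dq; have [W _ imE] := chart_at_image p.
by have : (chart_at p @` dom (chart_at p)) (chart_at p q) by [exists q];
  rewrite imE => -[].
Qed.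

(** A chart is open onto its image, and the image of [chart_at p] is relatively open in the half
    space, so every half-space point near the image of [p] comes from a point near [p]. *)
Lemma chart_at_near p (P : M -> Prop) : (\forall q \near p, P q) ->
  \forall x \near chart_at p p, half_space x ->
    exists q, [/\ dom (chart_at p) q, chart_at p q = x & P q].
Proof.
move=> nP; set c := chart_at p.
pose V := interior [set q | P q] `&` dom c.
have oV : open V by apply: openI; [exact: open_interior | exact: dom_open].
have [W oW VW] := coord_open_image oV (@subIsetr _ _ _).
have [W' oW' cW] := chart_at_image p.
have Wp : W (c p).
  have : (c @` V) (c p) by exists p => //; split; [exact: nP | exact: chart_at_dom].
  by rewrite VW => -[].
have W'p : W' (c p).
  have : (c @` dom c) (c p) by exists p => //; exact: chart_at_dom.
  by rewrite cW => -[].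
have nW : \forall x \near c p, W x by exact: open_nbhs_nbhs.
have nW' : \forall x \near c p, W' x by exact: open_nbhs_nbhs.
apply: filterS2 nW nW' => x Wx W'x hx.
have : (c @` V) x by rewrite VW cW.
by move=> [q [/interior_subset Pq dq] <-]; exists q.
Qed.

(** Independence of the extension: two extensions agree near the image of [p] on the half space
    only. This fixes the derivatives in inward directions, and oddness in [v] settles the outward
    ones. *)
Lemma dfunE p f F v : local_expression (chart_at p) p f F ->
  dfun f p v = 'D_v F (chart_at p p).
Proof.
rewrite /dfun => fF; set G := xget _ _.
have fG : local_expression (chart_at p) p f G.
  by apply: (@xgetPex _ (cst 0) (local_expression (chart_at p) p f)); exists F.
set a := chart_at p p.
have [sF nF] := fF; have [sG nG] := fG.
have FG : \forall x \near a, half_space x -> G x = F x.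
  have /chart_at_near : \forall q \near p, G (chart_at p q) = F (chart_at p q).
    by apply: filterS2 nF nG => q <- <-.
  by apply: filterS => x nx /nx [q [_ <-]].
have a0 : 0 <= a 0 0 by apply: chart_at_ge0; exact: chart_at_dom.
have dF := smooth_near_differentiable sF.
have dG := smooth_near_differentiable sG.
have pos (u : 'rV[R]_m.+1) : 0 <= u 0 0 -> 'D_u G a = 'D_u F a.
  move=> u0; apply: derive_eq_right => //; first exact: (nbhs_singleton FG).
  have FGu : \forall h \near (0 : R)^'+,
      half_space (h *: u + a) -> G (h *: u + a) = F (h *: u + a).
    by apply: cvg_within; exact: (near_line u FG).
  near=> h; apply: (near FGu h) => //; rewrite /half_space /= !mxE.
  by rewrite addr_ge0 // mulr_ge0 // ltW.
(* If [v] points out of the half space, then [- v] points into it. *)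
have [/pos //|v0] := leP 0 (v 0 0).
have := pos (- v); rewrite !derive_dirN // mxE oppr_ge0 => /(_ (ltW v0)).
exact: oppr_inj.
Unshelve. all: by end_near. Qed.

Lemma smooth_at_chart_fun c p i : is_chart c -> dom c p ->
  smooth_at p (chart_fun c i).
Proof. by move=> hc cp; have [] := hc p p (chart_at_dom p) cp i. Qed.

Lemma smooth_inP c p f : is_chart c -> dom c p -> smooth_in c p f <-> smooth_at p f.
Proof.
move=> hc cp; split; apply: smooth_in_change => i.
  exact: smooth_at_chart_fun.
by have [] := hc p p (chart_at_dom p) cp i.
Qed.

Lemma is_chart_at p : is_chart (chart_at p).
Proof. by move=> q; exact: chart_at_compatible. Qed.

Lemma smooth_at_near p f : smooth_at p f -> \forall q \near p, smooth_at q f.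
Proof.
move=> [F /(local_expression_near (chart_at_dom p))]; apply: filterS => q [dq fF].
by apply/(smooth_inP f (@is_chart_at p) dq); exists F.
Qed.

Lemma dfun_linear p f : smooth_at p f ->
  exists l : {linear 'rV[R]_m.+1 -> R}, dfun f p =1 l.
Proof.
move=> [F fF]; exists ('d F (chart_at p p)) => v.
by rewrite (dfunE _ fF) deriveE //; apply: smooth_near_differentiable; case: fF.
Qed.

Lemma dfunD p f v w : smooth_at p f -> dfun f p (v + w) = dfun f p v + dfun f p w.
Proof. by move=> /dfun_linear[l lE]; rewrite !lE linearD. Qed.

Lemma dfunZ p f r v : smooth_at p f -> dfun f p (r *: v) = r * dfun f p v.
Proof. by move=> /dfun_linear[l lE]; rewrite !lE linearZ. Qed.

Lemma dfun0 p f : smooth_at p f -> dfun f p 0 = 0.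
Proof. by move=> /dfun_linear[l lE]; rewrite !lE linear0. Qed.

Lemma dfun_sum p f n (v : 'I_n -> 'rV[R]_m.+1) : smooth_at p f ->
  dfun f p (\sum_i v i) = \sum_i dfun f p (v i).
Proof.
by move=> /dfun_linear[l lE]; rewrite lE linear_sum; apply: eq_bigr => i _.
Qed.

Lemma dfun_mulmx p f v : smooth_at p f ->
  dfun f p v = \sum_k v 0 k * dfun f p (delta_mx 0 k).
Proof.
move=> sf; rewrite {1}(row_sum_delta v) dfun_sum //.
by apply: eq_bigr => k _; rewrite dfunZ.
Qed.

(** [dfun] is computed in [chart_at p]; composing [F] with the transition map turns it into a local
    expression there, and the chain rule applies. *)
Lemma dfun_chain c p f F v : is_chart c -> dom c p -> local_expression c p f F ->
  dfun f p v = \sum_j dfun (chart_fun c j) p v * 'D_(delta_mx 0 j) F (c p).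
Proof.
move=> hc cp fF.
have /choice[K cK] : forall j, smooth_at p (chart_fun c j).
  by move=> j; exact: smooth_at_chart_fun.
have Kp : row_fun K (chart_at p p) = c p.
  by apply/rowP => j; rewrite mxE; have [_ /nbhs_singleton] := cK j.
rewrite (dfunE v (local_expression_comp cK fF)) derive_row_fun_comp.
- by apply: eq_bigr => j _; rewrite Kp (dfunE v (cK j)).
- by move=> j; apply: smooth_near_differentiable; case: (cK j).
- by rewrite Kp; apply: smooth_near_differentiable; case: fF.
Qed.

(** The matrix inverted in [coord_field]; it acts on row vectors from the right. *)
Definition jacobian_at c p : 'M[R]_m.+1 :=
  \matrix_(k, j) dfun (chart_fun c j) p (delta_mx 0 k).

Lemma dfun_jacobian c p v j : is_chart c -> dom c p ->
  dfun (chart_fun c j) p v = (v *m jacobian_at c p) 0 j.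
Proof.
move=> hc cp; rewrite dfun_mulmx; last exact: smooth_at_chart_fun.
by rewrite mxE; apply: eq_bigr => k _; rewrite mxE.
Qed.

(** The inverse is the matrix [B] of partial derivatives, in the chart [c], of the coordinates of
    [chart_at p]. *)
Lemma jacobian_at_unit c p : is_chart c -> dom c p -> jacobian_at c p \in unitmx.
Proof.
move=> hc cp.
have /choice[F fF] : forall i, smooth_in c p (chart_fun (chart_at p) i).
  by move=> i; have [] := hc p p (chart_at_dom p) cp i.
pose B : 'M[R]_m.+1 := \matrix_(j, i) 'D_(delta_mx 0 j) (F i) (c p).
suff /mulmx1_unit[] : jacobian_at c p *m B = 1%:M by [].
apply/matrixP => k i; rewrite !mxE.
transitivity (dfun (chart_fun (chart_at p) i) p (delta_mx 0 k)).
  by rewrite (dfun_chain _ hc cp (fF i)); apply: eq_bigr => j _; rewrite !mxE.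
have iE := @local_expression_coord _ _ _ (chart_at p) p i.
rewrite (dfunE _ iE).
have id_der : derivable (@id 'rV[R]_m.+1) (chart_at p p) (delta_mx 0 k) by [].
have := derive_mx id_der; rewrite derive_id => /matrixP/(_ 0 i).
by rewrite [RHS]mxE => <-; rewrite mxE eqxx eq_sym.
Qed.

Lemma dfun_coord_field c p i j : is_chart c -> dom c p ->
  dfun (chart_fun c j) p (coord_field c i p) = (i == j)%:R.
Proof.
move=> hc cp; rewrite dfun_jacobian // -row_mul mulVmx ?jacobian_at_unit //.
by rewrite !mxE.
Qed.

Lemma coord_field_sum c p v : is_chart c -> dom c p ->
  v = \sum_i dfun (chart_fun c i) p v *: coord_field c i p.
Proof.
move=> hc cp.
rewrite -{1}(mulmx1 v) -(mulmxV (jacobian_at_unit hc cp)) mulmxA mulmx_sum_row.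
by apply: eq_bigr => i _; rewrite dfun_jacobian.
Qed.

(** Read in [c], a coordinate field acts as a partial derivative; the smoothness of coordinate
    fields rests on this. *)
Lemma near_coord_field c p f F k : is_chart c -> dom c p ->
  local_expression c p f F ->
  \forall q \near p, apply_field (coord_field c k) f q = 'D_(delta_mx 0 k) F (c q).
Proof.
move=> hc cp /(local_expression_near cp); apply: filterS => q [cq fF].
rewrite /apply_field (dfun_chain _ hc cq fF) (bigD1 k) //= big1 ?addr0.
  by rewrite dfun_coord_field // eqxx mul1r.
by move=> j jk; rewrite dfun_coord_field // eq_sym (negbTE jk) mul0r.
Qed.

Lemma smooth_at_coord_field c p f k : is_chart c -> dom c p -> smooth_at p f ->
  smooth_at p (apply_field (coord_field c k) f).
Proof.
move=> hc cp /(smooth_inP f hc cp)[F fF].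
apply/(smooth_inP _ hc cp).
exists (fun x => 'D_(delta_mx 0 k) F x); split; last exact: near_coord_field fF.
by apply: smooth_near_partial; case: fF.
Qed.

(** Smoothness of a field at [p] is tested on the coordinates of [chart_at p] at nearby points [q];
    linearity of [dfun] at [q] requires these coordinates to be smooth there. *)
Lemma near_chart_at_smooth p i :
  \forall q \near p, smooth_at q (chart_fun (chart_at p) i).
Proof.
by apply/smooth_at_near/smooth_at_chart_fun;
  [exact: (@is_chart_at p) | exact: chart_at_dom].
Qed.

Lemma smooth_coord_field c (U : set M) k : is_chart c -> U `<=` dom c ->
  smooth_field U (coord_field c k).
Proof.
move=> hc Uc p /Uc cp i; apply: smooth_at_coord_field => //.
by apply: smooth_at_chart_fun; [exact: (@is_chart_at p) | exact: chart_at_dom].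
Qed.

Lemma smooth_field0 (U : set M) : smooth_field U (fun=> 0).
Proof.
move=> p Up i; apply: near_eq_smooth_in (smooth_in_cst _ _ 0).
by apply: filterS (near_chart_at_smooth p i) => q sq; rewrite /apply_field dfun0.
Qed.

Lemma smooth_fieldD (U : set M) (X Y : vfield M) :
  smooth_field U X -> smooth_field U Y -> smooth_field U (fun q => X q + Y q).
Proof.
move=> sX sY p Up i; apply: near_eq_smooth_in (smooth_inD (sX p Up i) (sY p Up i)).
by apply: filterS (near_chart_at_smooth p i) => q sq; rewrite /apply_field dfunD.
Qed.

Lemma smooth_fieldZ (U : set M) f (X : vfield M) :
  smooth_fun U f -> smooth_field U X -> smooth_field U (fun q => f q *: X q).
Proof.
move=> sf sX p Up i; apply: near_eq_smooth_in (smooth_inM (sf p Up) (sX p Up i)).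
by apply: filterS (near_chart_at_smooth p i) => q sq; rewrite /apply_field dfunZ.
Qed.

Lemma smooth_field_sum (U : set M) n (f : 'I_n -> M -> R) (X : 'I_n -> vfield M) :
  (forall i, smooth_fun U (f i)) -> (forall i, smooth_field U (X i)) ->
  smooth_field U (fun q => \sum_i f i q *: X i q).
Proof.
elim: n f X => [|n IH] f X sf sX.
  under eq_fun do rewrite big_ord0.
  exact: smooth_field0.
under eq_fun do rewrite big_ord_recl.
by apply: smooth_fieldD; [exact: smooth_fieldZ | exact: IH].
Qed.

End Differentials.

(** * The boundary and its tangent space *)

Section Boundary.
Context {R : realType} {m : nat} {M : bmanifold R m}.
Implicit Types (p q : M) (f g : M -> R) (c : chart R m M) (v w : 'rV[R]_m.+1).

(* At an interior point the coordinate x^0 >= 0 could vanish only at a minimum,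
   where its differential would be zero. *)
Lemma mboundary_chart_at p q :
  dom (chart_at p) q -> chart_at p q 0 0 = 0 -> mboundary q.
Proof.
move=> dq pq0; rewrite /mboundary /=; apply/eqP; apply: contraT => q0.
have {}q0 : 0 < chart_at q q 0 0.
  by rewrite lt_neqAle eq_sym q0 chart_at_ge0 //; exact: chart_at_dom.
pose f := chart_fun (chart_at p) 0.
have sf : smooth_at q f by apply: smooth_at_chart_fun dq; exact: (@is_chart_at _ _ _ p).
have [F fF] := sf; have [sF nF] := fF.
have F0 : F (chart_at q q) = 0 by rewrite -(nbhs_singleton nF).
have nd : \forall q' \near q, dom (chart_at p) q'.
  exact: open_nbhs_nbhs (conj (dom_open _) dq).
have hF : \forall x \near chart_at q q, half_space x -> 0 <= F x.
  have /chart_at_near : \forall q' \near q, 0 <= F (chart_at q q').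
    by apply: filterS2 nF nd => q' <- /chart_at_ge0.
  by apply: filterS => x nx /nx [q' [_ <-]].
have nh : \forall x \near chart_at q q, half_space x.
  have c0 : (x : 'rV[R]_m.+1) 0 0 @[x --> chart_at q q] --> chart_at q q 0 0.
    exact: coord_continuous.
  exact: (cvgr_ge _ c0 _ q0).
have ge0 v : 0 <= dfun f q v.
  rewrite (dfunE _ fF); apply: derive_ge0; first exact: smooth_near_differentiable.
  have F_ge0 : \forall x \near chart_at q q, 0 <= F x.
    by apply: filterS2 nh hF => x hx; exact.
  by rewrite F0; apply: cvg_within; exact: (near_line v F_ge0).
have := ge0 (-1 *: coord_field (chart_at p) 0 q).
rewrite dfunZ // dfun_coord_field //; last exact: (@is_chart_at _ _ _ p).
by rewrite eqxx mulr1 oppr_ge0 ler10.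
Qed.

(** In [chart_at p] the points with [x^0 = 0] lie on the boundary, and the line through the image of
    [p] in direction [v] stays in that hyperplane, so [F] vanishes along it near the image of
    [p]. *)
Lemma dfun_mboundary p f v : mboundary p -> smooth_at p f ->
  (\forall q \near p, mboundary q -> f q = 0) -> v 0 0 = 0 -> dfun f p v = 0.
Proof.
move=> bp [F fF] f0 v0; have [sF nF] := fF.
have F0 : \forall x \near chart_at p p, (x : 'rV[R]_m.+1) 0 0 = 0 -> F x = 0.
  have /chart_at_near : \forall q \near p,
      dom (chart_at p) q -> chart_at p q 0 0 = 0 -> F (chart_at p q) = 0.
    by apply: filterS2 nF f0 => q <- f0 dq q0; apply: f0; exact: mboundary_chart_at q0.
  apply: filterS => x nx x0; have [|q [dq qx Fq]] := nx.
    by rewrite /half_space /= x0.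
  by rewrite -qx Fq // qx.
rewrite (dfunE _ fF) -[RHS](derive_cst 0 (chart_at p p) v).
apply: derive_eq_right; [exact: smooth_near_differentiable | by [] | |].
  by apply: (nbhs_singleton F0).
apply: cvg_within; apply: filterS (near_line v F0) => h; apply.
by rewrite !mxE v0 mulr0 add0r.
Qed.

(** Since [r] vanishes on the boundary, [dr] kills the hyperplane [v 0 0 = 0]; a larger kernel would
    be the whole space, against [dr(d_0) = 1]. As the hyperplane does not involve [c], all boundary
    charts share this kernel. *)
Lemma boundary_chart_tangent c p v : boundary_chart c -> dom c p -> mboundary p ->
  dfun (chart_fun c 0) p v = 0 <-> v 0 0 = 0.
Proof.
move=> [hc bE _] cp bp; have s0 := smooth_at_chart_fun 0 hc cp.
have tan w : w 0 0 = 0 -> dfun (chart_fun c 0) p w = 0.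
  apply: dfun_mboundary => //.
  have : \forall q \near p, dom c q by exact: open_nbhs_nbhs (conj (dom_open c) cp).
  apply: filterS => q cq bq.
  by have : (@mboundary _ _ M `&` dom c) q by []; rewrite bE => -[].
split; last exact: tan.
apply: contraPeq => v0 dv0.
have e1 : dfun (chart_fun c 0) p (coord_field c 0 p) = 1.
  by rewrite dfun_coord_field // eqxx.
pose e := coord_field c 0 p.
(* The multiple of [v] is chosen to cancel the normal component of [e]; yet [dr] takes the value 1
   on this vector if it kills [v]. *)
have : dfun (chart_fun c 0) p (e + (- (e 0 0 / v 0 0)) *: v) = 0.
  by apply: tan; rewrite !mxE mulNr divfK // subrr.
by rewrite dfunD // dfunZ // e1 dv0 mulr0 addr0 => /eqP; rewrite oner_eq0.
Qed.

End Boundary.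

(** * Connections applied to finite sums of fields *)

Section Connections.
Context {R : realType} {m : nat} {M : bmanifold R m}.
Variables (nabla : vfield M -> vfield M -> vfield M) (U : set M).
Hypotheses (hnabla : affine_connection nabla) (oU : open U).
Implicit Types (p : M) (X Y : vfield M).

(** The zero field is the zero function times itself, so homogeneity applies; this is the base case
    for sums. *)
Lemma nabla0l Y p : smooth_field U Y -> U p -> nabla (fun=> 0) Y p = 0.
Proof.
move=> sY Up; have s0 := @smooth_field0 _ _ _ U.
have sc : smooth_fun U (cst (0 : R)) by move=> q _; exact: smooth_in_cst.
have := nablaZl hnabla oU sc s0 sY (mem_set Up).
rewrite [RHS]scale0r => E; rewrite -[RHS]E.
by congr (nabla _ _ _); apply/funext => q; rewrite scaler0.
Qed.

Lemma nabla0r X p : smooth_field U X -> U p -> nabla X (fun=> 0) p = 0.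
Proof.
move=> sX Up; have s0 := @smooth_field0 _ _ _ U.
have sc : smooth_fun U (cst (0 : R)) by move=> q _; exact: smooth_in_cst.
have := nabla_leibniz hnabla oU sc sX s0 (mem_set Up).
rewrite [RHS](_ : _ = 0); last by rewrite scaler0 scale0r addr0.
move=> E; rewrite -[RHS]E.
by congr (nabla _ _ _); apply/funext => q; rewrite scaler0.
Qed.

Lemma nabla_suml n (f : 'I_n -> M -> R) (X : 'I_n -> vfield M) Y p :
  (forall i, smooth_fun U (f i)) -> (forall i, smooth_field U (X i)) ->
  smooth_field U Y -> U p ->
  nabla (fun q => \sum_i f i q *: X i q) Y p = \sum_i f i p *: nabla (X i) Y p.
Proof.
move=> + + sY Up; elim: n f X => [|n IH] f X sf sX.
  by under eq_fun do rewrite big_ord0; rewrite big_ord0 nabla0l.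
under eq_fun do rewrite big_ord_recl.
rewrite (nablaDl hnabla oU _ _ sY (mem_set Up)); first last.
- exact: smooth_field_sum.
- exact: smooth_fieldZ.
by rewrite big_ord_recl IH // (nablaZl hnabla oU (sf _) (sX _) sY (mem_set Up)).
Qed.

Lemma nabla_sumr n (f : 'I_n -> M -> R) X (Y : 'I_n -> vfield M) p :
  (forall i, smooth_fun U (f i)) -> (forall i, smooth_field U (Y i)) ->
  smooth_field U X -> U p ->
  nabla X (fun q => \sum_i f i q *: Y i q) p =
  \sum_i (apply_field X (f i) p *: Y i p + f i p *: nabla X (Y i) p).
Proof.
move=> + + sX Up; elim: n f Y => [|n IH] f Y sf sY.
  by under eq_fun do rewrite big_ord0; rewrite big_ord0 nabla0r.
under eq_fun do rewrite big_ord_recl.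
rewrite (nablaDr hnabla oU sX _ _ (mem_set Up)); first last.
- exact: smooth_field_sum.
- exact: smooth_fieldZ.
by rewrite big_ord_recl IH // (nabla_leibniz hnabla oU (sf _) sX (sY _) (mem_set Up)).
Qed.

End Connections.

(** * The Thomas condition under a change of boundary chart *)

Section ChangeOfBoundaryChart.
Context {R : realType} {m : nat} {M : bmanifold R m}.
Variable (nabla : vfield M -> vfield M -> vfield M).
Implicit Types (c : chart R m M) (p : M).

(** A linear form is a multiple of [dx^0] exactly when it kills every [d_k] with [k != 0], and on
    these the trace terms of [thomas] drop out. *)
Lemma thomas_normalP c p : is_chart c -> dom c p ->
  thomas_normal c nabla p <->
  forall j k, j != 0 -> k != 0 -> christoffel c nabla 0 j k p = 0.
Proof.
move=> hc cp.
have thE j k : j != 0 -> k != 0 ->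
    thomas c nabla 0 j k p = christoffel c nabla 0 j k p.
  by move=> j0 k0; rewrite /thomas !(eq_sym 0) (negbTE j0) (negbTE k0) !mulr0 !subr0.
split=> [th j k j0 k0|ch j j0].
  have [a /(_ (coord_field c k p))] := th j j0.
  rewrite dfun_coord_field // (negbTE k0) mulr0 /thomas_form (bigD1 k) //= big1.
    by rewrite addr0 dfun_coord_field // eqxx mulr1 thE.
  by move=> i ik; rewrite dfun_coord_field // eq_sym (negbTE ik) mulr0.
(* Only the [dx^0] term of the form survives, so its coefficient is the multiple. *)
exists (thomas c nabla 0 j 0 p) => v.
rewrite /thomas_form (bigD1 0) //= big1 ?addr0 // => k k0.
by rewrite thE // ch // mul0r.
Qed.

Lemma christoffel_boundary_chart c c' p : affine_connection nabla ->
  boundary_chart c -> boundary_chart c' -> dom c p -> dom c' p -> mboundary p ->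
  (forall j k, j != 0 -> k != 0 -> christoffel c nabla 0 j k p = 0) ->
  forall j k, j != 0 -> k != 0 -> christoffel c' nabla 0 j k p = 0.
Proof.
move=> hnabla bc bc' cp c'p bp ch j k j0 k0.
have [hc _ _] := bc; have [hc' _ _] := bc'.
(* The two differentials have the same kernel at [p], so the covariant derivative of the [c'] fields
   may be tested against [dr] of [c]. *)
apply/(boundary_chart_tangent _ bc' c'p bp)/(boundary_chart_tangent _ bc cp bp).
pose U := dom c `&` dom c'.
have oU : open U by apply: openI; exact: dom_open.
have Up : U p by [].
have Uc : U `<=` dom c by move=> q [].
have Uc' : U `<=` dom c' by move=> q [].
pose D i := coord_field c i.
pose D' i := coord_field c' i.
have sD i : smooth_field U (D i) by exact: smooth_coord_field.
have sD' i : smooth_field U (D' i) by exact: smooth_coord_field.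
(* [A l i] is the component of [D' l] along [D i], an entry of the Jacobian of the chart change. *)
pose A l i : M -> R := apply_field (D' l) (chart_fun c i).
have sA l i : smooth_fun U (A l i).
  move=> q [cq c'q]; apply: smooth_at_coord_field => //.
  exact: smooth_at_chart_fun.
have D'E l : {in U, D' l =1 fun q => \sum_i A l i q *: D i q}.
  by move=> q /set_mem[cq _]; exact: coord_field_sum.
have sS l : smooth_field U (fun q => \sum_i A l i q *: D i q).
  exact: smooth_field_sum.
have D'tan q l : U q -> mboundary q -> l != 0 -> (D' l q) 0 0 = 0.
  move=> [cq c'q] bq l0; apply/(boundary_chart_tangent _ bc' c'q bq).
  by rewrite dfun_coord_field // (negbTE l0).
(* The vanishing is needed along the boundary near [p], not just at [p], because [A k 0] gets
   differentiated below. *)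
have Atan q l : U q -> mboundary q -> l != 0 -> A l 0 q = 0.
  move=> Uq bq l0; apply/(boundary_chart_tangent _ bc (Uc q Uq) bq).
  exact: D'tan.
have s0 := smooth_at_chart_fun 0 hc cp.
rewrite -/(D' j) -/(D' k).
rewrite (nabla_local hnabla oU (sD' j) (sD' k) (fun q _ => erefl) (D'E k) (mem_set Up)).
rewrite (nabla_sumr hnabla oU) // dfun_sum // big1 // => b _.
rewrite dfunD // !dfunZ // dfun_coord_field //.
(* The Leibniz term contributes to [dr] only for [b = 0], and there [D' j] is tangent to the
   boundary, on which [A k 0] vanishes. *)
have -> : apply_field (D' j) (A k b) p * (b == 0)%:R = 0.
  have [->|] := eqVneq b 0; last by rewrite mulr0.
  rewrite mulr1; apply: dfun_mboundary => //; first exact: sA; last exact: D'tan.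
  have : \forall q \near p, U q by exact: open_nbhs_nbhs.
  by apply: filterS => q Uq bq; exact: Atan.
rewrite add0r; have [->|b0] := eqVneq b 0; first by rewrite Atan // mul0r.
(* With [b != 0], the first argument is expanded as well; it is not differentiated, so only values
   at [p] matter. *)
rewrite (nabla_local hnabla oU (sD' j) (sD b) (D'E j) (fun q _ => erefl) (mem_set Up)).
rewrite (nabla_suml hnabla oU) // dfun_sum // big1 ?mulr0 // => a _.
rewrite dfunZ //; have [->|a0] := eqVneq a 0; first by rewrite Atan // mul0r.
by have := ch a b a0 b0; rewrite /christoffel => ->; rewrite mulr0.
Qed.

End ChangeOfBoundaryChart.

Theorem proposition1p1 (R : realType) (m : nat) (hn : (2 <= m.+1)%N)
  (M : bmanifold R m) (C : set (vfield M -> vfield M -> vfield M))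
  (hC : projective_structure C) (p : M) (hp : mboundary p) :
  (exists c : chart R m M, [/\ boundary_chart c, dom c p &
     forall nabla, C nabla -> thomas_normal c nabla p]) ->
  forall c : chart R m M, boundary_chart c -> dom c p ->
    forall nabla, C nabla -> thomas_normal c nabla p.
Proof.
move=> [c [bc cp normal]] c' bc' c'p nabla Cnabla.
have hnabla : affine_connection nabla.
  by move: hC Cnabla => [nabla0 [_ _ ->]] [].
have [hc _ _] := bc; have [hc' _ _] := bc'.
apply/(thomas_normalP nabla hc' c'p).
apply: (christoffel_boundary_chart hnabla bc bc' cp c'p hp).
(* The hypothesis on [c] is used for the very connection [nabla] under test in [c']. *)
by apply/(thomas_normalP nabla hc cp); exact: normal.
Qed.
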